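(* A probability measure $\pi\in\Gamma(\mu_0,\mu_1,\dots,\mu_d)$, where $\mu_0=\alpha_\#\mathrm{Leb}_{[0,1]}$, maximizes $$\tilde\pi\mapsto\int_{X_0\times X_1\times\cdots\times X_d} x_0\,b(x_1,\dots,x_d)\,d\tilde\pi(x_0,x_1,\dots,x_d)$$ over $\Gamma(\mu_0,\mu_1,\dots,\mu_d)$ if and only if both of the following hold: (i) the $(1,\dots,d)$-marginal of $\pi$ maximizes $\gamma\mapsto\mathcal R_\alpha(b_\#\gamma)$ over $\Gamma(\mu_1,\dots,\mu_d)$; and (ii) the measure $\tau_\pi=\big((x_0,x_1,\dots,x_d)\mapsto(x_0,b(x_1,\dots,x_d))\big)_\#\pi\in\mathcal P(\mathbb R^2)$ has monotone increasing support.
   Context: $X_1,\dots,X_d$ are Polish spaces, $\mu_i\in\mathcal P(X_i)$ are Borel probability measures, and $b:X_1\times\cdots\times X_d\to\mathbb R$ is a (Borel) output function. The spectral function $\alpha:[0,1]\to[0,\infty)$ is nondecreasing (hence bounded), $\mathrm{Leb}_{[0,1]}$ is Lebesgue measure on $[0,1]$, $X_0=[\alpha(0),\alpha(1)]$ and $\mu_0=\alpha_\#\mathrm{Leb}_{[0,1]}$. $T_\#\mu$ denotes the push-forward of $\mu$ by $T$. $\Gamma(\mu_0,\dots,\mu_d)$ (resp. $\Gamma(\mu_1,\dots,\mu_d)$) is the set of Borel probability measures on $X_0\times\cdots\times X_d$ (resp. $X_1\times\cdots\times X_d$) with marginals $\mu_i$. The $(1,\dots,d)$-marginal of $\pi$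 is its push-forward under $(x_0,x_1,\dots,x_d)\mapsto(x_1,\dots,x_d)$. For $\mu\in\mathcal P(\mathbb R)$, $F_\mu(x)=\mu((-\infty,x])$, $F_\mu^{-1}(m)=\inf\{x\in\mathbb R: F_\mu(x)\ge m\}$, and the spectral risk measure ($\alpha$-risk), regarded as a real-valued functional on $\mathcal P(\mathbb R)$, is $\mathcal R_\alpha(\mu)=\int_0^1F_\mu^{-1}(m)\alpha(m)\,dm$. A measure on $\mathbb R^2$ has monotone increasing support if $(x-x')(y-y')\ge0$ for all $(x,y),(x',y')$ in its support. *)

(* Defs.v *)
From HB Require Import structures.
From mathcomp Require Import all_boot all_order all_algebra.
From mathcomp Require Import all_classical all_reals all_analysis.

Set Implicit Arguments.
Unset Strict Implicit.
Unset Printing Implicit Defensive.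

Import Order.TTheory GRing.Theory Num.Theory.
Import numFieldNormedType.Exports.

Local Open Scope classical_set_scope.
Local Open Scope ring_scope.

Definition separable (T : topologicalType) : Prop :=
  exists2 S : set T, countable S & dense S.

Definition is_metric (R : realType) (T : Type) (dist : T -> T -> R) : Prop :=
  [/\ forall x y, 0 <= dist x y,
      forall x y, dist x y = 0 <-> x = y,
      forall x y, dist x y = dist y x
    & forall x y z, dist x z <= dist x y + dist y z].

Definition induces_topology (R : realType) (T : topologicalType)
    (dist : T -> T -> R) : Prop :=
  forall (x : T) (A : set T),
    nbhs x A <-> exists2 e : R, 0 < e & [set y | dist x y < e] `<=` A.

Definition complete_metric (R : realType) (T : topologicalType)
    (dist : T -> T -> R) : Prop :=
  forall u : nat -> T,
    (forall e : R, 0 < e -> exists N : nat, forall m n : nat,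
       (N <= m)%N -> (N <= n)%N -> dist (u m) (u n) < e) ->
    exists l : T, u n @[n --> \oo] --> l.

Definition polish (R : realType) (T : topologicalType) : Prop :=
  separable T /\
  exists dist : T -> T -> R,
    [/\ is_metric dist, induces_topology dist & complete_metric dist].

(* The library's measurable types are pointed, hence [ptopologicalType]; this
   is no restriction on a space that carries a probability measure. *)
Definition borel (T : ptopologicalType) :
    measurableType (sigma_display (@open T)) :=
  [the measurableType _ of g_sigma_algebraType (@open T)].

(* Only the values on [0, 1] matter: everything below depends on [alpha]
   through its restriction to [0, 1]. *)
Record spectral_function (R : realType) := SpectralFunction {
  spectral_fun :> R -> R;
  spectral_ge0 : forall m, m \in `[0, 1] -> 0 <= spectral_fun m;
  spectral_homo : {in `[0, 1] &, {homo spectral_fun : m n / m <= n}} }.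

Section spectral_range.
Context {R : realType}.

Definition spectral_range (alpha : spectral_function R) : Type :=
  set_type `[alpha 0, alpha 1]%classic.

Variable alpha : spectral_function R.

HB.instance Definition _ := Topological.copy (spectral_range alpha)
  (set_type `[alpha 0, alpha 1]%classic).

Definition spectral_val (x : spectral_range alpha) : R := set_val x.

Let spectral_range0 : alpha 0 \in `[alpha 0, alpha 1]%classic.
Proof.
rewrite inE /= in_itv/= lexx/=.
by apply: spectral_homo; rewrite ?in_itv/= ?lexx ?ler01.
Qed.

HB.instance Definition _ := isPointed.Build (spectral_range alpha)
  (exist _ (alpha 0) spectral_range0).

(* The push-forward by [alpha] of Lebesgue measure on [0, 1]. *)
Definition spectral_law (A : set (spectral_range alpha)) : \bar R :=
  lebesgue_measure (`[0, 1]%classic `&` alpha @^-1` (spectral_val @` A)).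

End spectral_range.

Section risk.
Context {R : realType}.
Local Open Scope ereal_scope.

(* [F_mu^-1 m = inf {x | m <= F_mu x}], finite for [0 < m < 1]; the values at
   [m = 0] and [m = 1] may be infinite, which the integral does not see. *)
Definition quantile (mu : probability R R) (m : R) : \bar R :=
  ereal_inf [set x%:E | x in [set x : R | m%:E <= mu `]-oo, x]%classic]].

(* Equal to a finite value exactly when the integrand is integrable, that is,
   when the risk is real-valued: undefined integrals evaluate to [-oo]. *)
Definition spectral_risk (alpha : spectral_function R)
    (mu : probability R R) : \bar R :=
  \int[lebesgue_measure]_(m in `[0%R, 1%R]) (quantile mu m * (alpha m)%:E).

End risk.

HB.instance Definition _ (I : Type) (X : I -> ptopologicalType) :=
  Pointed.copy (prod_topology X) (forall i, X i).

Definition product_space (d : nat) (X : 'I_d -> ptopologicalType) :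
    ptopologicalType := [the ptopologicalType of prod_topology X].

HB.instance Definition _ (S T : ptopologicalType) :=
  Pointed.on (S * T)%type.

(* [X_0 * X_1 * ... * X_d], with [X_0 = [alpha 0, alpha 1]]. *)
Definition extended_space (R : realType) (alpha : spectral_function R)
    (d : nat) (X : 'I_d -> ptopologicalType) : ptopologicalType :=
  [the ptopologicalType of (spectral_range alpha * product_space X)%type].

Section couplings.
Context {R : realType} {d : nat} {X : 'I_d -> ptopologicalType}.

Definition coupling (mu : forall i, probability (borel (X i)) R) :
    set (probability (borel (product_space X)) R) :=
  [set g | forall i (A : set (borel (X i))), measurable A ->
     g [set x | A (x i)] = mu i A].

Variable alpha : spectral_function R.

Definition extended_coupling (mu : forall i, probability (borel (X i)) R) :
    set (probability (borel (extended_space alpha X)) R) :=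
  [set p |
    (forall A : set (borel [the ptopologicalType of spectral_range alpha]),
       measurable A ->
       p [set z | A z.1] = spectral_law A) /\
    (forall i (A : set (borel (X i))), measurable A ->
       p [set z | A (z.2 i)] = mu i A)].

Definition drop_spectral (z : borel (extended_space alpha X)) :
  borel (product_space X) := z.2.

Let measurable_drop_spectral : measurable_fun setT drop_spectral.
Proof.
refine (@measurability _ _ _ _ _ _ _ _ _) => //.
move=> _ [A oA <-]; rewrite setTI; apply: sub_sigma_algebra.
by apply: open_comp oA => z _; exact: cvg_snd.
Qed.

HB.instance Definition _ := isMeasurableFun.Build _ _ _ _ drop_spectral
  measurable_drop_spectral.

(* The (1, ..., d)-marginal. *)
Definition output_marginal
    (p : probability (borel (extended_space alpha X)) R) :
  probability (borel (product_space X)) R := distribution p drop_spectral.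

(* [tau_p] as a set function; measurability of the map is not needed to
   form it. *)
Definition output_law (b : product_space X -> R)
    (p : probability (borel (extended_space alpha X)) R) :
    set (R * R) -> \bar R :=
  pushforward p
    (fun z : borel (extended_space alpha X) => (spectral_val z.1, b z.2)).

End couplings.

Definition measure_support (R : realType) (T : topologicalType)
    (m : set T -> \bar R) : set T :=
  [set x | forall U : set T, open U -> U x -> (0 < m U)%E].

Definition monotone_increasing_support (R : realType)
    (m : set (R * R) -> \bar R) : Prop :=
  forall p q : R * R, measure_support m p -> measure_support m q ->
    0 <= (p.1 - q.1) * (p.2 - q.2).

Definition maximizes (R : realType) (T : Type) (F : T -> \bar R) (S : set T)
    (x : T) : Prop :=
  S x /\ forall y, S y -> (F y <= F x)%E.

(* Main.v *)
(** Let U be uniform on [0, 1], Q the quantile function of b under a coupling g,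
    so that R_alpha (b # g) = E[alpha(U) Q(U)] is the value of a comonotone pair.
    The layer-cake formula writes E[x0 b^+] and E[x0 b^-] as integrals over
    levels t, s >= 0 of quadrant probabilities such as P(t < x0, s < b).  With
    both marginal laws fixed, P(t < x0, s < b) is maximal for comonotone pairs,
    with deficit the smaller of P(t < x0, b <= s) and P(x0 <= t, s < b).  Hence
    E[x0 b] <= R_alpha (b # g) for every extended coupling over g, and since the
    risk is finite, equality forces the deficit to vanish, which means that the
    law of (x0, b) has monotone support.  Conversely, equality is attained over
    every g: lift g by x0 = alpha(L), where L is the distributional transform
    F(b-) + V (F(b) - F(b-)) with V uniform and independent of the coordinates;
    L is uniform and comonotone with b. *)
Require Import Defs.
From HB Require Import structures.
From mathcomp Require Import all_boot all_order all_algebra.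
From mathcomp Require Import all_classical all_reals all_analysis.
From mathcomp Require Import measurable_realfun.
From mathcomp Require Import lra.

Set Implicit Arguments.
Unset Strict Implicit.
Unset Printing Implicit Defensive.

Import Order.TTheory GRing.Theory Num.Theory.
Import numFieldNormedType.Exports.

Local Open Scope classical_set_scope.
Local Open Scope ring_scope.

(** * Planar Lebesgue measure on the pairs of levels *)

Section lebesgue2.
Context {R : realType}.
Local Open Scope ereal_scope.

(* Named so as to carry a sigma-finite instance: the one inferred for [_ \x _]
   is keyed on subprobabilities. *)
Definition lebesgue2 := (@lebesgue_measure R \x @lebesgue_measure R).

HB.instance Definition _ := Measure.on lebesgue2.

Lemma lebesgue2_co (a b c e : R) : (a <= b)%R -> (c <= e)%R ->
  lebesgue2 (`[a, b[ `*` `[c, e[) = ((b - a) * (e - c))%:E.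
Proof.
have itvE (u v : R) : (u <= v)%R ->
    @lebesgue_measure R `[u, v[ = (v - u)%:E.
  move=> uv; rewrite lebesgue_measure_itv/= lte_fin.
  by move: uv; rewrite le_eqVlt => /predU1P[->|->//]; rewrite ltxx subrr.
by move=> ab ce; rewrite /lebesgue2 [LHS]product_measure1E// EFinM -!itvE.
Qed.

Let lebesgue2_sigma_finite : sigma_finite setT lebesgue2.
Proof.
exists (fun n => `[- n%:R, n%:R[ `*` `[- n%:R, n%:R[)%R.
  apply/esym; rewrite -subTset => -[x y] _ /=; move: x y => /= x y.
  have [n xyn] : exists n, (Num.max `|x : R| `|y : R| < n%:R)%R.
    exists (Num.bound (Num.max `|x : R| `|y : R|))%R.
    by rewrite archi_boundP// le_max normr_ge0.
  exists n => //=; move: xyn; rewrite gt_max !ltr_norml !in_itv/=.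
  by move=> /andP[/andP[/ltW -> ->] /andP[/ltW -> ->]].
by move=> n; split; [exact: measurableX|rewrite lebesgue2_co ?ltry// ge0_cp].
Qed.

HB.instance Definition _ :=
  Measure_isSigmaFinite.Build _ _ _ lebesgue2 lebesgue2_sigma_finite.

End lebesgue2.

(** * The layer-cake formula and comparison of layers *)

Section layer_cake.
Context d (T : measurableType d) (R : realType).
Local Open Scope ereal_scope.

Lemma measurable_strip (f : T -> R) (mf : measurable_fun setT f)
    (D : set (T * R)) : measurable D ->
  measurable [set z : T * (R * R) |
    (0 <= z.2.1 < f z.1)%R /\ D (z.1, z.2.2)].
Proof.
move=> mD.
apply: measurableI; last first.
  have mh : measurable_fun setT (fun z : T * (R * R) => (z.1, z.2.2)).
    by apply: measurable_fun_pair; [exact: measurable_fst|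
      exact: measurableT_comp measurable_snd measurable_snd].
  by rewrite -[X in measurable X]setTI; exact: mh.
have mb : measurable_fun setT (fun z : T * (R * R) => (0 <= z.2.1 < f z.1)%R).
  apply: measurable_and.
    apply: measurable_fun_ler => //.
    exact: measurableT_comp measurable_fst measurable_snd.
  apply: measurable_fun_ltr.
    exact: measurableT_comp measurable_fst measurable_snd.
  exact: measurableT_comp mf measurable_fst.
by rewrite -[X in measurable X]setTI; exact: (mb measurableT [set true]).
Qed.

(** Tonelli: both sides are the [P \x lebesgue2] mass of the triples [(x, (t, s))] with
    [0 <= t < f x] and [(x, s)] in [D], whose section at [x] is [[0, f x[] times [xsection D x]. *)
Lemma layer_cake (P : probability T R) (f : T -> R)
    (mf : measurable_fun setT f) (f0 : forall x, (0 <= f x)%R)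
    (D : set (T * R)) (mD : measurable D) :
  \int[P]_x ((f x)%:E * lebesgue_measure (xsection D x)) =
  \int[@lebesgue2 R]_ts
    P [set x | (0 <= ts.1 < f x)%R /\ D (x, ts.2)].
Proof.
pose E := [set z : T * (R * R) | (0 <= z.2.1 < f z.1)%R /\ D (z.1, z.2.2)].
have mE : measurable E by exact: measurable_strip.
have -> : \int[P]_x ((f x)%:E * lebesgue_measure (xsection D x)) =
    (P \x @lebesgue2 R) E.
  apply: eq_integral => x _ /=.
  have -> : xsection E x = `[0%R, f x[ `*` xsection D x.
    apply/seteqP; split=> [[t s]|[t s]].
      rewrite /xsection/= inE => -[/= ft Dx]; rewrite in_itv/=.
      by split => //; rewrite inE.
    by rewrite /xsection/= !in_itv/= !inE => -[].
  rewrite [RHS]product_measure1E//; last exact: measurable_xsection.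
  congr (_ * _).
  have := lebesgue_measure_itv (Interval (BLeft 0%R) (BLeft (f x))) => /= ->.
  rewrite lte_fin sube0.
  by have := f0 x; rewrite le_eqVlt => /predU1P[<-|->//]; rewrite ltxx.
transitivity ((P \x^ @lebesgue2 R) E).
  apply: product_measure_unique => // A B mA mB.
  by rewrite [LHS]product_measure2E.
apply: eq_integral => ts _ /=; congr (P _); apply/seteqP.
by split=> x; rewrite /ysection/= inE.
Qed.

Lemma measurable_layer (P : probability T R) (f : T -> R)
    (mf : measurable_fun setT f) (D : set (T * R)) (mD : measurable D) :
  measurable_fun setT (fun ts : R * R =>
    P [set x | (0 <= ts.1 < f x)%R /\ D (x, ts.2)]).
Proof.
have := measurable_fun_ysection P (measurable_strip mf mD).
apply: eq_measurable_fun => ts _ /=; congr (P _).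
by apply/seteqP; split=> x; rewrite /ysection/= inE.
Qed.

End layer_cake.

Section layer_le.
Context d (T : measurableType d) d' (T' : measurableType d') (R : realType).
Context (P : probability T R) (P' : probability T' R).
Local Open Scope ereal_scope.

(** The layers are compared pointwise and integrated over the levels; a deficit of [e] throughout
    the box of levels contributes [e] times its area. *)
Lemma layer_le (f : T -> R) (f' : T' -> R) (D : set (T * R))
    (D' : set (T' * R)) (t0 t1 s0 s1 e : R) :
  measurable_fun setT f -> measurable_fun setT f' ->
  (forall x, (0 <= f x)%R) -> (forall x, (0 <= f' x)%R) ->
  measurable D -> measurable D' ->
  (0 <= e)%R -> (0 <= t0)%R -> (t0 <= t1)%R -> (s0 <= s1)%R ->
  (forall t s, (0 <= t)%R -> P [set x | (t < f x)%R /\ D (x, s)] <=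
                             P' [set x | (t < f' x)%R /\ D' (x, s)]) ->
  (forall t s, (t0 <= t < t1)%R -> (s0 <= s < s1)%R ->
    P [set x | (t < f x)%R /\ D (x, s)] + e%:E <=
    P' [set x | (t < f' x)%R /\ D' (x, s)]) ->
  \int[P]_x ((f x)%:E * lebesgue_measure (xsection D x)) +
    (e * ((t1 - t0) * (s1 - s0)))%:E <=
  \int[P']_x ((f' x)%:E * lebesgue_measure (xsection D' x)).
Proof.
move=> mf mf' f0 f'0 mD mD' e0 t00 t01 s01 H1 H2.
rewrite !layer_cake//.
pose B := `[t0, t1[%classic `*` `[s0, s1[%classic.
have mB : measurable B by exact: measurableX.
have -> : (e * ((t1 - t0) * (s1 - s0)))%:E =
    \int[@lebesgue2 R]_ts (e%:E * (\1_B ts)%:E).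
  rewrite ge0_integralZl//; last exact/measurable_EFinP/measurable_indic.
  by rewrite integral_indic// setIT EFinM -lebesgue2_co.
have mI : measurable_fun setT (fun ts : R * R => e%:E * (\1_B ts)%:E).
  by apply: measurable_funeM; exact/measurable_EFinP/measurable_indic.
have I0 ts : 0 <= e%:E * (\1_B ts)%:E by rewrite mule_ge0// lee_fin.
rewrite -ge0_integralD//; last exact: measurable_layer.
apply: ge0_le_integral => //.
- by move=> ts _; rewrite adde_ge0.
- by apply: emeasurable_funD => //; exact: measurable_layer.
- exact: measurable_layer.
move=> [t s] _ /=.
have [t_ge0|t_lt0] := leP 0%R t; last first.
  rewrite (_ : [set _ | _] = set0); last by apply/seteqP; split=> // x [].
  rewrite measure0 add0e.
  have -> : \1_B (t, s) = 0%R :> R.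
    rewrite indicE memNset// /B/= !in_itv/= => -[/andP[+ _] _].
    by apply/negP; rewrite -ltNge (lt_le_trans t_lt0).
  by rewrite mule0.
have [Bts|Bts] := boolP ((t, s) \in B).
  rewrite indicE Bts mule1.
  move: Bts; rewrite inE /B/= !in_itv/= => -[tt ss].
  exact: H2.
by rewrite indicE (negbTE Bts) mule0 adde0; exact: H1.
Qed.

End layer_le.

(** * Quadrant masses and comonotone pairs *)

Section quadrants.
Context d (T : measurableType d) (R : realType).
Local Open Scope ereal_scope.

(* No mass on one of two opposite quadrants; unlike a condition on the support,
   this makes sense on an arbitrary measurable space. *)
Definition comonotone (P : set T -> \bar R) (f g : T -> R) :=
  forall t s, P [set x | (t < f x)%R /\ (g x <= s)%R] = 0 \/
              P [set x | (f x <= t)%R /\ (s < g x)%R] = 0.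

Lemma measurable_gtr (f : T -> R) t : measurable_fun setT f ->
  measurable [set x | (t < f x)%R].
Proof.
move=> mf; have := mf measurableT _ (measurable_itv `]t, +oo[).
by rewrite setTI preimage_itvoy.
Qed.

Lemma measurable_ler (f : T -> R) t : measurable_fun setT f ->
  measurable [set x | (f x <= t)%R].
Proof.
move=> mf; have := mf measurableT _ (measurable_itv `]-oo, t]).
by rewrite setTI preimage_itvNyc.
Qed.

Lemma quadrantE (P : probability T R) (f g : T -> R) t s :
  measurable_fun setT f -> measurable_fun setT g ->
  exists a b c : R,
    [/\ P [set x | (t < f x)%R /\ (s < g x)%R] = a%:E,
        P [set x | (t < f x)%R /\ (g x <= s)%R] = b%:E,
        P [set x | (f x <= t)%R /\ (s < g x)%R] = c%:E,
        P [set x | (t < f x)%R] = (a + b)%:E &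
        P [set x | (s < g x)%R] = (a + c)%:E].
Proof.
move=> mf mg.
have mF u := measurable_gtr u mf; have mF' u := measurable_ler u mf.
have mG u := measurable_gtr u mg; have mG' u := measurable_ler u mg.
have mA : measurable [set x | (t < f x)%R /\ (s < g x)%R].
  exact: (measurableI _ _ (mF t) (mG s)).
have mB : measurable [set x | (t < f x)%R /\ (g x <= s)%R].
  exact: (measurableI _ _ (mF t) (mG' s)).
have mC : measurable [set x | (f x <= t)%R /\ (s < g x)%R].
  exact: (measurableI _ _ (mF' t) (mG s)).
exists (fine (P [set x | (t < f x)%R /\ (s < g x)%R])),
  (fine (P [set x | (t < f x)%R /\ (g x <= s)%R])),
  (fine (P [set x | (f x <= t)%R /\ (s < g x)%R])).
rewrite !EFinD !fineK ?fin_num_measure//; split => //.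
  rewrite -measureU//; last first.
    by apply/seteqP; split => // x [[_ sg] [_]]; rewrite leNgt sg.
  congr (P _); apply/seteqP; split => x /=; last by case=> -[].
  by move=> ->; case: (ltP s (g x)); [left|right].
rewrite -measureU//; last first.
  by apply/seteqP; split => // x [[tf _] [+ _]]; rewrite leNgt tf.
congr (P _); apply/seteqP; split => x /=; last by case=> -[].
by move=> ->; case: (ltP t (f x)); [left|right].
Qed.

End quadrants.

(** * Positive and negative parts of the integral of a product *)

Section parts.
Context d (T : measurableType d) (R : realType).
Local Open Scope ereal_scope.

(** The two parts are kept apart because for nonnegative [f] each has a nonnegative integrand, hence
    is open to the layer-cake formula even when infinite. *)
Definition posint (P : set T -> \bar R) (f g : T -> R) :=
  \int[P]_x ((f x)%:E * (Num.max (g x) 0)%:E).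

Definition negint (P : set T -> \bar R) (f g : T -> R) :=
  \int[P]_x ((f x)%:E * (Num.max (- g x) 0)%:E).

(** The ends of the sections are chosen to match the quadrants: at [s >= 0] this region reads
    [s < g x], and at [s > 0] the region [neg_region] reads [g x <= - s]. *)
Definition pos_region (g : T -> R) := [set z : T * R | (0 <= z.2 < g z.1)%R].

Definition neg_region (g : T -> R) := [set z : T * R | (0 < z.2 <= - g z.1)%R].

Lemma measurable_pos_region g : measurable_fun setT g ->
  measurable (pos_region g).
Proof.
move=> mg.
have mb : measurable_fun setT (fun z : T * R => (0 <= z.2 < g z.1)%R).
  apply: measurable_and.
    by apply: measurable_fun_ler => //; exact: measurable_snd.
  by apply: measurable_fun_ltr; [exact: measurable_snd|
    exact: measurableT_comp mg measurable_fst].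
by rewrite -[X in measurable X]setTI; exact: (mb measurableT [set true]).
Qed.

Lemma measurable_neg_region g : measurable_fun setT g ->
  measurable (neg_region g).
Proof.
move=> mg.
have mb : measurable_fun setT (fun z : T * R => (0 < z.2 <= - g z.1)%R).
  apply: measurable_and.
    by apply: measurable_fun_ltr => //; exact: measurable_snd.
  apply: measurable_fun_ler; first exact: measurable_snd.
  by apply: measurable_funN; exact: measurableT_comp mg measurable_fst.
by rewrite -[X in measurable X]setTI; exact: (mb measurableT [set true]).
Qed.

Lemma posintE (P : probability T R) f g :
  posint P f g =
  \int[P]_x ((f x)%:E * lebesgue_measure (xsection (pos_region g) x)).
Proof.
apply: eq_integral => x _; congr (_ * _).
have -> : xsection (pos_region g) x = `[0%R, g x[%classic.
  by apply/seteqP; split=> s; rewrite /xsection/= ?inE ?in_itv/= ?inE.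
rewrite lebesgue_measure_itv/= lte_fin sube0.
by case: ltP => // g0; rewrite /Num.max ltNge g0.
Qed.

Lemma negintE (P : probability T R) f g :
  negint P f g =
  \int[P]_x ((f x)%:E * lebesgue_measure (xsection (neg_region g) x)).
Proof.
apply: eq_integral => x _; congr (_ * _).
have -> : xsection (neg_region g) x = `]0%R, (- g x)%R]%classic.
  by apply/seteqP; split=> s; rewrite /xsection/= ?inE ?in_itv/= ?inE.
rewrite lebesgue_measure_itv/= lte_fin sube0.
by case: ltP => // g0; rewrite /Num.max ltNge g0.
Qed.

End parts.

(** * The rearrangement inequality and its equality case *)

Section rearrangement.
Context d (T : measurableType d) d' (T' : measurableType d') (R : realType).
Context (P : probability T R) (P' : probability T' R).
Context (f g : T -> R) (f' g' : T' -> R).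
Hypothesis mf : measurable_fun setT f.
Hypothesis mg : measurable_fun setT g.
Hypothesis mf' : measurable_fun setT f'.
Hypothesis mg' : measurable_fun setT g'.
Hypothesis f0 : forall x, 0 <= f x.
Hypothesis f'0 : forall x, 0 <= f' x.
Local Open Scope ereal_scope.
Hypothesis tail_f : forall t,
  P [set x | (t < f x)%R] = P' [set x | (t < f' x)%R].
Hypothesis tail_g : forall s,
  P [set x | (s < g x)%R] = P' [set x | (s < g' x)%R].
Hypothesis comon : comonotone P' f' g'.

(** With [a], [b], [c] as in [quadrantE] and primes for [P'], equal tails give
    [a' - a = b - b' = c - c']. Comonotonicity makes [b'] or [c'] vanish, so this difference is at
    least the minimum of [b] and [c]. *)
Lemma quadrant_le t s (e : R) :
  e%:E <= P [set x | (t < f x)%R /\ (g x <= s)%R] ->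
  e%:E <= P [set x | (f x <= t)%R /\ (s < g x)%R] ->
  P [set x | (t < f x)%R /\ (s < g x)%R] + e%:E <=
    P' [set x | (t < f' x)%R /\ (s < g' x)%R] /\
  P' [set x | (t < f' x)%R /\ (g' x <= s)%R] + e%:E <=
    P [set x | (t < f x)%R /\ (g x <= s)%R].
Proof.
have [a [b [c [-> -> -> ab ac]]]] := quadrantE P t s mf mg.
have := comon t s.
have [a' [b' [c' [-> -> -> ab' ac']]]] := quadrantE P' t s mf' mg'.
have := tail_f t; have := tail_g s; rewrite ab ac ab' ac' => -[Eac] [Eab].
rewrite -!EFinD !lee_fin => -[[z]|[z]] eb ec; split; lra.
Qed.

(* [e] bounds the deficit from below on a box of levels; an empty box gives the
   plain inequality. *)
Lemma posint_gap (t0 t1 s0 s1 e : R) : (0 <= e)%R ->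
  (0 <= t0)%R -> (t0 <= t1)%R -> (0 <= s0)%R -> (s0 <= s1)%R ->
  (forall t s, (t0 <= t < t1)%R -> (s0 <= s < s1)%R ->
    e%:E <= P [set x | (t < f x)%R /\ (g x <= s)%R] /\
    e%:E <= P [set x | (f x <= t)%R /\ (s < g x)%R]) ->
  posint P f g + (e * ((t1 - t0) * (s1 - s0)))%:E <= posint P' f' g'.
Proof.
move=> e0 t00 t01 s00 s01 H; rewrite !posintE.
apply: layer_le => //; try exact: measurable_pos_region.
- move=> t s t_ge0; rewrite /pos_region/=.
  have [s_ge0|s_lt0] := leP 0%R s; last first.
    rewrite (_ : [set x | _] = set0) ?measure0//.
    by apply/seteqP; split => // x [].
  have [] := @quadrant_le t s 0 => //.
  by rewrite !adde0.
- move=> t s tt ss; rewrite /pos_region/=.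
  have s_ge0 : (0 <= s)%R by move/andP : ss => [+ _]; exact: le_trans.
  rewrite s_ge0/=; have [H1 H2] := H t s tt ss.
  by have [] := quadrant_le H1 H2.
Qed.

(** The negative part is built from the quadrants [g <= s], whose mass comonotonicity minimizes,
    hence the reversed inequality. Passing from the level [s] to [- s] moves the closed end of the
    box to [s1]. *)
Lemma negint_gap (t0 t1 s0 s1 e : R) : (0 <= e)%R ->
  (0 <= t0)%R -> (t0 <= t1)%R -> (s1 < 0)%R -> (s0 <= s1)%R ->
  (forall t s, (t0 <= t < t1)%R -> (s0 < s <= s1)%R ->
    e%:E <= P [set x | (t < f x)%R /\ (g x <= s)%R] /\
    e%:E <= P [set x | (f x <= t)%R /\ (s < g x)%R]) ->
  negint P' f' g' + (e * ((t1 - t0) * (s1 - s0)))%:E <= negint P f g.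
Proof.
move=> e0 t00 t01 s10 s01 H; rewrite !negintE.
rewrite (_ : s1 - s0 = - s0 - (- s1))%R; last by rewrite opprK addrC.
have regE (h s : R) : (0 < s <= - h)%R = (0 < s)%R && (h <= - s)%R.
  by rewrite lerNr.
apply: layer_le => //; try exact: measurable_neg_region.
- by rewrite lerN2.
- move=> t s t_ge0; rewrite /neg_region/=.
  under eq_set do rewrite regE; under [in leRHS]eq_set do rewrite regE.
  have [s_le0|s_gt0] := leP s 0%R.
    rewrite (_ : [set x | _] = set0) ?measure0//.
    by apply/seteqP; split => // x [].
  have [] := @quadrant_le t (- s)%R 0 => //.
  by rewrite !adde0.
- move=> t s tt ss; rewrite /neg_region/=.
  under eq_set do rewrite regE; under [in leRHS]eq_set do rewrite regE.
  have s_gt0 : (0 < s)%R by move/andP : ss => [+ _]; apply: lt_le_trans; lra.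
  have ss' : (s0 < - s <= s1)%R by lra.
  rewrite s_gt0/=; have [H1 H2] := H t _ tt ss'.
  by have [] := quadrant_le H1 H2.
Qed.

Lemma posint_le : posint P f g <= posint P' f' g'.
Proof.
have := @posint_gap 0 0 0 0 0; rewrite !mul0r adde0; exact.
Qed.

Lemma negint_le : negint P' f' g' <= negint P f g.
Proof.
have := @negint_gap 0 0 (-1) (-1) 0; rewrite !mul0r adde0; exact.
Qed.

(** If both quadrants had positive mass, the smaller mass [e] would bound the deficit from below on
    a box of positive area, and this would separate integrals that are finite and equal. *)
Lemma uncrossed (t0 t1 s0 s1 : R) :
  posint P' f' g' < +oo -> negint P' f' g' < +oo ->
  posint P f g = posint P' f' g' -> negint P f g = negint P' f' g' ->
  (t0 < t1)%R -> (s0 < s1)%R ->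
  P [set x | (t1 < f x)%R /\ (g x <= s0)%R] = 0 \/
  P [set x | (f x <= t0)%R /\ (s1 < g x)%R] = 0.
Proof.
move=> posfin negfin posE negE t01 s01.
set B := [set x | _ /\ (g x <= s0)%R]; set C := [set x | _ /\ (s1 < g x)%R].
have mB : measurable B.
  exact: (measurableI _ _ (measurable_gtr t1 mf) (measurable_ler s0 mg)).
have mC : measurable C.
  exact: (measurableI _ _ (measurable_ler t0 mf) (measurable_gtr s1 mg)).
(* The gap lemmas ask for [0 <= t0]; for negative [t0] the quadrant [f <= t0] is empty since [f] is
   nonnegative. *)
have [t00|t00] := ltP t0 0%R.
  right; rewrite (_ : C = set0) ?measure0//; apply/seteqP; split => // x [].
  by move=> /le_lt_trans /(_ t00); rewrite ltNge f0.
apply: contrapT => /not_orP[/eqP B0 /eqP C0].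
pose e := (Num.min (fine (P B)) (fine (P C)))%R.
have e0 : (0 < e)%R.
  have fine_pos A : measurable A -> P A != 0 -> (0 < fine (P A))%R.
    move=> mA A0; rewrite fine_gt0// lt0e A0 measure_ge0.
    by rewrite ltey_eq fin_num_measure.
  by rewrite lt_min !fine_pos.
have eB : e%:E <= P B.
  by rewrite -(fineK (fin_num_measure P _ mB)) lee_fin ge_min lexx.
have eC : e%:E <= P C.
  by rewrite -(fineK (fin_num_measure P _ mC)) lee_fin ge_min lexx orbT.
have H t s : (t0 <= t < t1)%R -> (s0 <= s <= s1)%R ->
    e%:E <= P [set x | (t < f x)%R /\ (g x <= s)%R] /\
    e%:E <= P [set x | (f x <= t)%R /\ (s < g x)%R].
  move=> /andP[t0t tt1] /andP[s0s ss1]; split.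
    apply: (le_trans eB); apply: le_measure; rewrite ?inE//.
      exact: (measurableI _ _ (measurable_gtr t mf) (measurable_ler s mg)).
    by move=> x [/(lt_trans tt1) tf /le_trans gs]; split; [|exact: gs].
  apply: (le_trans eC); apply: le_measure; rewrite ?inE//.
    exact: (measurableI _ _ (measurable_ler t mf) (measurable_gtr s mg)).
  by move=> x [/le_trans ft /(le_lt_trans ss1)]; split; [exact: ft|].
have gap_contra (I J : \bar R) u v : 0 <= I -> I < +oo -> J = I ->
    (u < v)%R -> ~ (J + (e * ((t1 - t0) * (v - u)))%:E <= I).
  move=> I0 Ioo -> uv; have /fineK <- : I \is a fin_num by rewrite ge0_fin_numE.
  rewrite -EFinD lee_fin gerDl; apply/negP; rewrite -ltNge.
  by rewrite !mulr_gt0// subr_gt0.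
have part_ge0 (h : T' -> R) :
    0 <= \int[P']_x ((f' x)%:E * (Num.max (h x) 0)%:E).
  by apply: integral_ge0 => x _; rewrite mule_ge0// lee_fin// le_max lexx orbT.
have [s00|s00] := leP 0%R s0.
  apply: (gap_contra _ _ s0 s1 _ posfin posE s01); first exact: part_ge0.
  apply: posint_gap => //; rewrite ?ltW// => t s tt /andP[s0s ss1].
  by apply: H => //; rewrite s0s ltW.
(* Here [s0 < 0]: cutting the box at [s0 / 2] keeps it nonempty and inside the negative levels. *)
pose s1' := (Num.min s1 (s0 / 2))%R.
have s01' : (s0 < s1')%R by rewrite lt_min s01/=; lra.
have negfin' : negint P f g < +oo by rewrite negE.
apply: (gap_contra _ _ s0 s1' _ negfin' (esym negE) s01').
  by rewrite negE; exact: part_ge0.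
apply: negint_gap => //; rewrite ?ltW//.
  by rewrite gt_min; apply/orP; right; lra.
move=> t s tt /andP[s0s]; rewrite le_min => /andP[ss1 _].
by apply: H => //; rewrite ss1 ltW.
Qed.

End rearrangement.

Section integral_parts.
Context d (T : measurableType d) (R : realType).
Local Open Scope ereal_scope.

Lemma integral_posint_negint (mu : {measure set T -> \bar R}) (D : set T)
    (f g : T -> R) : (forall x, (0 <= f x)%R) ->
  \int[mu]_(x in D) (f x * g x)%:E =
  \int[mu]_(x in D) ((f x)%:E * (Num.max (g x) 0)%:E) -
  \int[mu]_(x in D) ((f x)%:E * (Num.max (- g x) 0)%:E).
Proof.
move=> f0; rewrite integralE; congr (_ - _); apply: eq_integral => x _.
  by rewrite funeposE -EFinM maxr_pMr// mulr0 EFin_max.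
by rewrite funenegE -EFinM maxr_pMr// mulr0 EFin_max mulrN EFinN.
Qed.

End integral_parts.

(** * Monotone extension of [alpha] to the real line *)

Section clamp01.
Context {R : realType}.

Definition clamp01 (u : R) : R := Num.max 0 (Num.min u 1).

Lemma clamp01_itv u : clamp01 u \in `[0, 1].
Proof. by rewrite in_itv/= le_max lexx/= ge_max ler01/= ge_min lexx orbT. Qed.

Lemma clamp01_id u : 0 <= u <= 1 -> clamp01 u = u.
Proof. by move=> /andP[u0 u1]; rewrite /clamp01 min_l// max_r. Qed.

Lemma clamp01_homo : {homo clamp01 : u v / u <= v}.
Proof.
move=> u v uv; rewrite /clamp01 ge_max !le_max lexx/= le_min !ge_min uv lexx.
by rewrite !orbT.
Qed.

Lemma measurable_clamp01 : measurable_fun setT clamp01.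
Proof. by apply: nondecreasing_measurable => // u v; exact: clamp01_homo. Qed.

End clamp01.

Section spectral_ext.
Context {R : realType}.

(* [alpha] is only known to be monotone on [[0, 1]]. *)
Definition spectral_ext (alpha : spectral_function R) (m : R) : R :=
  alpha (clamp01 m).

Variable alpha : spectral_function R.

Lemma spectral_ext_homo : {homo spectral_ext alpha : m n / m <= n}.
Proof.
by move=> m n mn; apply: spectral_homo; rewrite ?clamp01_itv// clamp01_homo.
Qed.

Lemma spectral_extE m : m \in `[0, 1] -> spectral_ext alpha m = alpha m.
Proof. by rewrite in_itv/= => m01; rewrite /spectral_ext clamp01_id. Qed.

Lemma spectral_ext_ge0 m : 0 <= spectral_ext alpha m.
Proof. exact/spectral_ge0/clamp01_itv. Qed.

Lemma spectral_ext_itv m : spectral_ext alpha m \in `[alpha 0, alpha 1].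
Proof.
have := clamp01_itv m; rewrite !in_itv/= => /andP[m0 m1].
by apply/andP; split; apply: spectral_homo;
  rewrite ?in_itv/= ?lexx ?ler01 ?m0 ?m1.
Qed.

Lemma measurable_spectral_ext : measurable_fun setT (spectral_ext alpha).
Proof.
by apply: nondecreasing_measurable => // m n; exact: spectral_ext_homo.
Qed.

End spectral_ext.

(** * The uniform law on [[0, 1]] *)

Section uniform01.
Context {R : realType}.
Local Open Scope ereal_scope.

Definition unif01 : probability (measurableTypeR R) R :=
  uniform_prob (@ltr01 R).

Lemma unif01E (A : set R) : measurable A ->
  unif01 A = lebesgue_measure (`[0%R, 1%R]%classic `&` A).
Proof.
move=> mA; rewrite /unif01/= /uniform_prob integral_uniform_pdf setIC.
rewrite (eq_integral (cst 1)); last first.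
  move=> x; rewrite inE/= in_itv/= => -[x01 _].
  by rewrite /uniform_pdf x01 subr0 invr1.
by rewrite integral_cst ?mul1e//; exact: measurableI.
Qed.

(** The endpoints are null, which matters because quantiles are controlled only on the open
    interval. *)
Lemma unif01_oo (A : set R) : measurable A ->
  unif01 A = lebesgue_measure (`]0%R, 1%R[%classic `&` A).
Proof.
move=> mA; rewrite unif01E//.
have -> : `[0%R, 1%R]%classic `&` A =
    (`]0%R, 1%R[%classic `&` A) `|` ([set 0%R; 1%R] `&` A).
  by rewrite -setIUl setUitv_set2.
have mI : measurable (`]0%R, 1%R[%classic `&` A) by exact: measurableI.
have mE : measurable ([set 0%R; 1%R] `&` A).
  by apply: measurableI => //; exact: measurableU.
rewrite measureU0//; apply/eqP; rewrite -measure_le0.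
have m01 : measurable ([set 0%R; 1%R] : set R) by exact: measurableU.
apply: (@le_trans _ _ (lebesgue_measure ([set 0%R; 1%R] : set R))).
  by apply: le_measure; rewrite ?inE.
rewrite measure_le0; apply/eqP/null_set_setU => //;
  exact: lebesgue_measure_set1.
Qed.

Lemma integral_unif01 (f : R -> \bar R) : measurable_fun setT f ->
  (forall x, 0 <= f x) ->
  \int[unif01]_x f x = \int[lebesgue_measure]_(x in `]0%R, 1%R[) f x.
Proof.
move=> mf f0; rewrite [LHS]integral_uniform// subr0 invr1 mul1e.
by rewrite integral_itv_bndoo//; exact: measurable_funTS.
Qed.

Lemma unif01_clamp01_lt (r : R) : (0 <= r <= 1)%R ->
  unif01 [set u : measurableTypeR R | (clamp01 u < r)%R] = r%:E.
Proof.
move=> /andP[r0 r1]; rewrite unif01E; last first.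
  have := @measurable_clamp01 R measurableT _ (measurable_itv `]-oo, r[).
  by rewrite setTI preimage_itvNyo.
have -> : `[0%R, 1%R]%classic `&` [set u | (clamp01 u < r)%R] =
    `[0%R, r[%classic.
  apply/seteqP; split => u /=; rewrite !in_itv/=.
    by move=> [u01]; rewrite clamp01_id//; case/andP: u01 => ->.
  move=> /andP[u0 ur]; have u1 : (u <= 1)%R by rewrite ltW// (lt_le_trans ur).
  by rewrite clamp01_id u0 u1.
rewrite lebesgue_measure_itv/= lte_fin sube0.
by case: ltP => // r0'; have -> : r = 0%R by apply/le_anti; rewrite r0 r0'.
Qed.

End uniform01.

(** * Quantile functions, their law and their comonotonicity *)

Section quantile.
Context d (T : measurableType d) (R : realType) (P : probability T R).
Variable X : {RV P >-> R}.
Local Open Scope ereal_scope.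

Let cdf_bounded (m : R) : (0 < m < 1)%R ->
  exists y z : R, cdf X y < m%:E /\ m%:E <= cdf X z.
Proof.
move=> /andP[m0 m1].
have [y ym] : exists y : R, cdf X y < m%:E.
  apply: contrapT => /forallNP H.
  have : m%:E <= 0.
    apply: cvge_ge (cvg_cdfNy0 X); apply: nearW => r.
    by rewrite leNgt; exact/negP/H.
  by rewrite lee_fin leNgt m0.
have [z mz] : exists z : R, m%:E <= cdf X z.
  apply: contrapT => /forallNP H.
  have : 1 <= m%:E.
    apply: cvge_le (cvg_cdfy1 X); apply: nearW => r.
    by rewrite leNgt; apply/negP => /ltW/H.
  by rewrite lee_fin leNgt m1.
by exists y, z.
Qed.

(** The Galois connection between quantile and distribution function; right continuity of the latter
    covers the case where [s] is the infimum itself. *)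
Lemma quantile_leP (m s : R) : (0 < m < 1)%R ->
  quantile (distribution P X) m <= s%:E <-> m%:E <= cdf X s.
Proof.
move=> m01; split => [qs|ms]; last first.
  by apply: ereal_inf_lbound; exists s.
have cv : cdf X r @[r --> s^'+] --> cdf X s by exact: cdf_right_continuous.
apply: cvge_ge cv.
near=> r.
have sr : (s < r)%R by [].
have /ereal_inf_lt[_ [x /= mx <-] xr] : quantile (distribution P X) m < r%:E.
  by rewrite (le_lt_trans qs)// lte_fin.
by rewrite (le_trans mx)// cdf_nondecreasing// -lee_fin ltW.
Unshelve. all: by end_near. Qed.

Lemma quantile_fin_num (m : R) : (0 < m < 1)%R ->
  quantile (distribution P X) m \is a fin_num.
Proof.
move=> m01; have [y [z [ym mz]]] := cdf_bounded m01.
rewrite fin_numElt; apply/andP; split.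
  rewrite (lt_le_trans (ltNyr y))//; apply: le_ereal_inf_tmp => _ [x /= mx <-].
  rewrite lee_fin leNgt; apply/negP => xy.
  have := lt_le_trans ym mx; rewrite ltNge cdf_nondecreasing// ltW//.
rewrite (le_lt_trans _ (ltry z))//; exact/quantile_leP.
Qed.

(** The value [0] off []0, 1[] is a default that hides possibly infinite quantiles at the endpoints;
    it concerns a null set of [unif01]. *)
Definition quantile_fun (m : R) : R :=
  if (0 < m < 1)%R then fine (quantile (distribution P X) m) else 0%R.

Lemma quantile_funE m : (0 < m < 1)%R ->
  (quantile_fun m)%:E = quantile (distribution P X) m.
Proof. by move=> m01; rewrite /quantile_fun m01 fineK// quantile_fin_num. Qed.

Lemma quantile_fun_leP (m s : R) : (0 < m < 1)%R ->
  (quantile_fun m <= s)%R <-> m%:E <= cdf X s.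
Proof.
by move=> m01; rewrite -lee_fin quantile_funE//; exact: quantile_leP.
Qed.

Lemma quantile_fun_ltP (m s : R) : (0 < m < 1)%R ->
  (s < quantile_fun m)%R <-> cdf X s < m%:E.
Proof.
move=> m01; rewrite !ltNge; split => /negP H; apply/negP => /quantile_fun_leP.
  by move=> /(_ m01).
by move=> /(_ m01).
Qed.

End quantile.

Lemma measurable_fun_gtr d (T : measurableType d) (R : realType) (f : T -> R) :
  (forall s, measurable [set x | s < f x]) -> measurable_fun setT f.
Proof.
move=> mf; apply: (measurability _ (RGenOInfty.measurableE R)) => //.
by move=> _ [_ [s ->] <-]; rewrite setTI preimage_itvoy.
Qed.

Section quantile_law.
Context d (T : measurableType d) (R : realType) (P : probability T R).
Variable X : {RV P >-> R}.
Local Open Scope ereal_scope.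

Lemma quantile_fun_homo (m n : R) : (0 < m < 1)%R -> (0 < n < 1)%R ->
  (m <= n)%R -> (quantile_fun X m <= quantile_fun X n)%R.
Proof.
move=> m01 n01 mn; apply/quantile_fun_leP => //.
by rewrite (@le_trans _ _ n%:E)//; exact/quantile_fun_leP.
Qed.

Let cdfK s : (fine (cdf X s))%:E = cdf X s.
Proof. by rewrite fineK// fin_num_measure. Qed.

Lemma quantile_fun_gtE s :
  `]0%R, 1%R[%classic `&` [set m | (s < quantile_fun X m)%R] =
  `]fine (cdf X s), 1%R[%classic :> set R.
Proof.
apply/seteqP; split => m /=; rewrite !in_itv/=.
  move=> [m01 /quantile_fun_ltP]; rewrite -cdfK lte_fin => /(_ m01) ->.
  by case/andP : m01.
move=> /andP[Fm m1]; have m01 : (0 < m < 1)%R.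
  by rewrite m1 andbT (le_lt_trans _ Fm)// fine_ge0.
by split => //; apply/quantile_fun_ltP => //; rewrite -cdfK lte_fin.
Qed.

Lemma measurable_quantile_fun :
  measurable_fun setT (quantile_fun X : measurableTypeR R -> R).
Proof.
apply: measurable_fun_gtr => s.
have mI : measurable (`]0%R, 1%R[%classic : set (measurableTypeR R)).
  exact: measurable_itv.
rewrite -(setIT [set _ | _]) -(setUv `]0%R, 1%R[%classic) setIUr.
apply: measurableU.
  by rewrite setIC quantile_fun_gtE; exact: measurable_itv.
(* Off []0, 1[] the function is the constant default [0], so only the sign of [s] matters. *)
have [s0|s0] := ltP s 0%R.
  rewrite setIidr; first exact: measurableC.
  by move=> m /=; rewrite in_itv/= /quantile_fun => /negP/negbTE ->.
rewrite (_ : _ `&` _ = set0)//; apply/seteqP; split => // m /= [].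
by rewrite in_itv/= /quantile_fun => + /negP/negbTE m01; rewrite m01 ltNge s0.
Qed.

(** Inverse transform sampling: by the Galois connection the superlevel set within []0, 1[] is []F
    s, 1[], with [F] the distribution function. *)
Lemma quantile_fun_tail s :
  unif01 [set m : measurableTypeR R | (s < quantile_fun X m)%R] =
  P [set x | (s < X x)%R].
Proof.
have mQ := measurable_gtr s measurable_quantile_fun.
rewrite unif01_oo//.
rewrite quantile_fun_gtE lebesgue_measure_itv/= lte_fin.
have F1 : (fine (cdf X s) <= 1)%R by rewrite -lee_fin cdfK cdf_le1.
have -> : P [set x | (s < X x)%R] = (1 - fine (cdf X s))%:E.
  rewrite EFinB cdfK.
  have -> : [set x | (s < X x)%R] = ~` (X @^-1` `]-oo, s]).
    by apply/seteqP; split=> x /=; rewrite in_itv/= ltNge => /negP.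
  by rewrite probability_setC//; exact: measurable_funPTI.
case: ltP => // F1'; suff -> : fine (cdf X s) = 1%R by rewrite subrr.
by apply/le_anti; rewrite F1 F1'.
Qed.

(** Monotonicity of both functions on []0, 1[] forbids points in two opposite quadrants, so one of
    them is empty there. *)
Lemma quantile_fun_comonotone (f : R -> R) :
  measurable_fun setT f -> {homo f : m n / (m <= n)%R} ->
  comonotone (unif01 : set (measurableTypeR R) -> \bar R) f (quantile_fun X).
Proof.
move=> mf fh t s.
have mQ := measurable_quantile_fun.
have mB := measurableI _ _ (measurable_gtr t mf) (measurable_ler s mQ).
have mC := measurableI _ _ (measurable_ler t mf) (measurable_gtr s mQ).
rewrite !unif01_oo//.
have [[m [m01 [tm ms]]]|H] := pselect (exists m : R,
    (0 < m < 1)%R /\ (t < f m)%R /\ (quantile_fun X m <= s)%R).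
  right; rewrite (_ : _ `&` _ = set0) ?measure0//.
  apply/seteqP; split => // n /= [n01 [nt sn]]; rewrite in_itv/= in n01.
  have [mn|/ltW nm] := leP m n.
    by have := lt_le_trans tm (fh _ _ mn); rewrite ltNge nt.
  have := quantile_fun_homo n01 m01 nm.
  by rewrite leNgt (le_lt_trans ms sn).
left; rewrite (_ : _ `&` _ = set0) ?measure0//.
apply/seteqP; split => // n /= [n01 [tn ns]]; apply: H; exists n.
by rewrite in_itv/= in n01.
Qed.

End quantile_law.

(** * The risk as the value of a comonotone pair *)

Section spectral_riskE.
Context d (T : measurableType d) (R : realType) (P : probability T R).
Variable X : {RV P >-> R}.
Local Open Scope ereal_scope.

Lemma spectral_riskE (alpha : spectral_function R) :
  spectral_risk alpha (distribution P X) =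
  posint (unif01 : set (measurableTypeR R) -> \bar R)
    (spectral_ext alpha) (quantile_fun X) -
  negint (unif01 : set (measurableTypeR R) -> \bar R)
    (spectral_ext alpha) (quantile_fun X).
Proof.
have mQ := measurable_quantile_fun X.
have ma := measurable_spectral_ext alpha.
have maQ : measurable_fun setT (fun m : measurableTypeR R =>
    (spectral_ext alpha m * quantile_fun X m)%:E).
  by apply/measurable_EFinP; exact: measurable_funM.
have E : {in `]0%R, 1%R[%classic, forall m : R,
    (spectral_ext alpha m * quantile_fun X m)%:E =
    quantile (distribution P X) m * (alpha m)%:E}.
  move=> m; rewrite inE/= in_itv/= => m01.
  rewrite EFinM quantile_funE// muleC spectral_extE// in_itv/=.
  by case/andP: m01 => /ltW -> /ltW ->.
rewrite /spectral_risk integral_itv_bndoo; last first.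
  by apply: eq_measurable_fun E _; exact: measurable_funTS.
under eq_integral do rewrite -E//.
rewrite integral_posint_negint; last exact: spectral_ext_ge0.
have a0 := spectral_ext_ge0 alpha.
rewrite /posint /negint; congr (_ - _); rewrite integral_unif01//.
- apply/measurable_EFinP.
  by apply: measurable_funM => //; exact: measurable_maxr.
- by move=> m; rewrite mule_ge0// lee_fin// le_max lexx orbT.
- apply/measurable_EFinP.
  apply: measurable_funM => //; apply: measurable_maxr => //.
  exact: measurable_funN.
- by move=> m; rewrite mule_ge0// lee_fin// le_max lexx orbT.
Qed.

End spectral_riskE.

(** * Uniqueness of laws on the real line *)

Section probability_unique.
Context {R : realType}.
Local Open Scope ereal_scope.

Lemma probability_itvcy_unique (P Q : probability R R) :
  (forall c, P `[c, +oo[%classic = Q `[c, +oo[%classic) ->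
  forall A, measurable A -> P A = Q A.
Proof.
move=> PQ A mA.
refine (@measure_unique _ _ _ (@RGenCInfty.G R)
  (fun n => `[(- n%:R)%R, +oo[%classic) (RGenCInfty.measurableE R)
  _ _ _ P Q _ _ A mA).
- move=> _ _ [a ->] [b ->]; exists (Num.max a b).
  by apply/seteqP; split => x /=; rewrite !in_itv/= !andbT ge_max => /andP.
- by move=> n; exists (- n%:R)%R.
- apply/seteqP; split => // x _.
  exists (Num.bound `|(x : R)|%R) => //=; rewrite in_itv/= andbT.
  have : (`|(x : R)| < (Num.bound `|(x : R)|)%:R)%R by exact: archi_boundP.
  by rewrite ltr_norml => /andP[/ltW].
- by move=> _ [a ->]; exact: PQ.
- by move=> n; rewrite (le_lt_trans (probability_le1 _ _)) ?ltry.
Qed.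

Lemma law_unique d (T : measurableType d) d' (T' : measurableType d')
    (P : probability T R) (Q : probability T' R) (f : T -> R) (g : T' -> R) :
  measurable_fun setT f -> measurable_fun setT g ->
  (forall c, P [set x | (c <= f x)%R] = Q [set x | (c <= g x)%R]) ->
  forall A, measurable A -> P (f @^-1` A) = Q (g @^-1` A).
Proof.
move=> mf mg PQ A mA.
apply: (@probability_itvcy_unique (distribution P (mfun_Sub (mem_set mf)))
  (distribution Q (mfun_Sub (mem_set mg)))) => // c.
transitivity (P [set x | (c <= f x)%R]); last rewrite PQ.
  by congr (P _); apply/seteqP; split => x /=; rewrite in_itv/= andbT.
by congr (Q _); apply/seteqP; split => x /=; rewrite in_itv/= andbT.
Qed.

End probability_unique.

(** * The distributional transform *)

Section level.
Context d (T : measurableType d) (R : realType) (P : probability T R).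
Variable X : {RV P >-> R}.
Local Open Scope ereal_scope.

(** [G] is the distribution function of [X] and [H] its left limit; [G y - H y] is the mass of the
    atom at [y]. *)
Let G (y : R) : R := fine (P [set x | (X x <= y)%R]).
Let H (y : R) : R := fine (P [set x | (X x < y)%R]).

(* The distributional transform: the conditional law of [level] given
   [X = y] is uniform on [[P (X < y), P (X <= y)]]. *)
Definition level (z : T * measurableTypeR R) : R :=
  (H (X z.1) + clamp01 z.2 * (G (X z.1) - H (X z.1)))%R.

Let mle y : measurable [set x | (X x <= y)%R].
Proof. exact/measurable_ler/measurable_funPT. Qed.

Let mlt y : measurable [set x | (X x < y)%R].
Proof.
have := measurable_funPTI X (measurable_itv `]-oo, y[).
by rewrite preimage_itvNyo.
Qed.

Let GE y : (G y)%:E = cdf X y.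
Proof.
by rewrite /G fineK ?fin_num_measure.
Qed.

Let HE y : (H y)%:E = P [set x | (X x < y)%R].
Proof. by rewrite fineK// fin_num_measure. Qed.

Let G_homo : {homo G : x y / (x <= y)%R}.
Proof.
move=> x y xy; rewrite -lee_fin !GE; exact: cdf_nondecreasing.
Qed.

Let H_homo : {homo H : x y / (x <= y)%R}.
Proof.
move=> x y xy; rewrite -lee_fin !HE; apply: le_measure; rewrite ?inE//.
by move=> z /= /lt_le_trans; apply.
Qed.

Let GH x y : (x < y)%R -> (G x <= H y)%R.
Proof.
move=> xy; rewrite -lee_fin HE /G fineK ?fin_num_measure//.
by apply: le_measure; rewrite ?inE// => z /= /le_lt_trans; apply.
Qed.

Let HG y : (H y <= G y)%R.
Proof.
rewrite -lee_fin HE /G fineK ?fin_num_measure//.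
by apply: le_measure; rewrite ?inE// => z /= /ltW.
Qed.

Let HGE y : (G y)%:E = (H y)%:E + P [set x | X x = y].
Proof.
have my : measurable [set x | X x = y].
  exact: (measurable_funPTI X (measurable_set1 y)).
rewrite HE /G fineK ?fin_num_measure// -measureU//.
  congr (P _); apply/seteqP; split => x /=.
    by rewrite le_eqVlt => /predU1P[->|]; [right|left].
  by case=> [/ltW//|->].
by apply/seteqP; split => // x /= [+ xy]; rewrite xy ltxx.
Qed.

Lemma level_bounds z : (H (X z.1) <= level z <= G (X z.1))%R.
Proof.
rewrite /level; have := HG (X z.1).
have := clamp01_itv z.2; rewrite in_itv/= => /andP[].
by set u := clamp01 _; nra.
Qed.

(** The intervals [[H x, G x]] attached to distinct values of [X] meet at most at endpoints and are
    ordered like these values. *)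
Lemma level_homo z w : (X z.1 < X w.1)%R -> (level z <= level w)%R.
Proof.
move=> /GH zw; have /andP[_ h] := level_bounds z.
by have /andP[+ _] := level_bounds w; apply: le_trans; exact: le_trans zw.
Qed.

Lemma measurable_level : measurable_fun setT level.
Proof.
have mX1 : measurable_fun setT (fun z : T * measurableTypeR R => X z.1).
  exact: measurableT_comp measurable_fst.
have mG : measurable_fun setT G.
  by apply: nondecreasing_measurable => // ? ?; exact: G_homo.
have mH : measurable_fun setT H.
  by apply: nondecreasing_measurable => // ? ?; exact: H_homo.
have mGX := measurableT_comp mG mX1; have mHX := measurableT_comp mH mX1.
apply: measurable_funD => //.
apply: measurable_funM; last exact: measurable_funB.
exact: measurableT_comp measurable_clamp01 measurable_snd.
Qed.

Lemma level_comonotone (f : R -> R) : {homo f : m n / (m <= n)%R} ->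
  comonotone (P \x unif01) (f \o level) (X \o fst).
Proof.
move=> fh t s.
have [[z [tz zs]]|E] :=
    pselect (exists z, (t < f (level z))%R /\ (X z.1 <= s)%R).
  right; rewrite (_ : [set _ | _] = set0) ?measure0//.
  apply/seteqP; split => // w /= [wt sw].
  have := lt_le_trans tz (fh _ _ (level_homo (le_lt_trans zs sw))).
  by rewrite ltNge wt.
left; rewrite (_ : [set _ | _] = set0) ?measure0//.
by apply/seteqP; split => // z /= tz; apply: E; exists z.
Qed.

(** Left of the quantile [y] the distribution function stays below [c], and [H y] is its limit along
    the increasing events [X <= y - 1/(n+1)]. *)
Let H_quantile c : (0 < c < 1)%R -> (H (quantile_fun X c) <= c)%R.
Proof.
move=> c01; rewrite -lee_fin HE; set y := quantile_fun X c.
pose F (n : nat) := [set x | (X x <= y - n.+1%:R^-1)%R].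
have FE : \bigcup_n F n = [set x | (X x < y)%R].
  apply/seteqP; split => [x [n _]|x /=]; rewrite /F/=.
    by move=> /le_lt_trans; apply; rewrite ltrBlDr ltrDl.
  rewrite -subr_gt0 => xy; have [n _ nxy] := near_infty_natSinv_lt (PosNum xy).
  exists n => //=; rewrite lerBrDr -lerBrDl ltW//.
  by have /= := nxy n (leqnn n).
have cvF : P (F n) @[n --> \oo] --> P [set x | (X x < y)%R].
  rewrite -FE; apply: nondecreasing_cvg_mu => //.
    by move=> n; exact: mle.
    by rewrite FE.
  move=> n m nm; apply/subsetPset => x /= /le_trans; apply.
  by rewrite lerD2l lerN2 lef_pV2 ?posrE// ler_nat.
apply: cvge_le cvF; apply: nearW => n.
have : (y - n.+1%:R^-1 < y)%R by rewrite ltrBlDr ltrDl.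
by move=> /quantile_fun_ltP-/(_ c01)/ltW; rewrite -GE /G fineK ?fin_num_measure.
Qed.

(** Where [X] is below the quantile [y] the level is less than [c], and above it the level is at
    least [c]. On the atom [X = y] a fraction [k] of the uniform variable is kept, with
    [H y + k (G y - H y) = c]. *)
Lemma level_lt (c : R) : (0 < c < 1)%R ->
  (P \x unif01) [set z | (level z < c)%R] = c%:E.
Proof.
move=> c01; set y := quantile_fun X c.
have hlt x : (x < y)%R -> (G x < c)%R.
  by move=> /quantile_fun_ltP-/(_ c01); rewrite -GE lte_fin.
have hge x : (y <= x)%R -> (c <= G x)%R.
  by move=> /quantile_fun_leP-/(_ c01); rewrite -GE lee_fin.
have Hc : (H y <= c)%R by exact: H_quantile.
pose k := unif01 [set u : measurableTypeR R |
  (H y + clamp01 u * (G y - H y) < c)%R].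
have my : measurable [set x | X x = y].
  exact: (measurable_funPTI X (measurable_set1 y)).
have -> : (P \x unif01) [set z | (level z < c)%R] =
    \int[P]_x ((\1_[set x | (X x < y)%R] x)%:E +
               k * (\1_[set x | X x = y] x)%:E).
  apply: eq_integral => x _ /=.
  have [xy|xy|xy] := ltgtP (X x) y.
  - rewrite !indicE mem_set// memNset; last first.
      by move=> /= e; move: xy; rewrite e ltxx.
    rewrite mule0 adde0 (_ : xsection _ _ = setT) ?probability_setT//.
    apply/seteqP; split => // u _; rewrite /xsection/= inE/=.
    have /andP[_ h] := level_bounds (x, u).
    by rewrite (le_lt_trans h)// hlt.
  - rewrite !indicE !memNset/=; last 2 first.
      by move=> e; move: xy; rewrite e ltxx.
      by apply/negP; rewrite -leNgt ltW.
    rewrite mule0 adde0 (_ : xsection _ _ = set0) ?measure0//.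
    apply/seteqP; split => // u; rewrite /xsection/= inE/=.
    have /andP[h _] := level_bounds (x, u).
    by rewrite ltNge (le_trans _ h)// (le_trans _ (GH xy))// hge.
  - rewrite !indicE memNset ?mem_set//; last by rewrite /= xy ltxx.
    rewrite mule1 add0e; congr (unif01 _).
    by apply/seteqP; split => u; rewrite /xsection/= inE /level/= xy.
have k0 : 0 <= k by exact: measure_ge0.
have mI A : measurable A ->
    measurable_fun setT (fun x : T => (\1_A x)%:E : \bar R).
  by move=> mA; exact/measurable_EFinP/measurable_indic.
have mkI : measurable_fun setT (fun x => k * (\1_[set x | X x = y] x)%:E).
  by apply: measurable_funeM; exact: mI.
have I0 (A : set T) x : 0 <= (\1_A x)%:E :> \bar R by rewrite lee_fin.
rewrite ge0_integralD//; first last.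
- by move=> x _; rewrite mule_ge0.
- exact: mI.
rewrite ge0_integralZl//; last exact: mI.
have Pmid : P [set x | X x = y] = (G y - H y)%:E.
  by rewrite EFinB HGE addeAC subee ?add0e.
transitivity ((H y)%:E + k * (G y - H y)%:E).
  rewrite !integral_indic// !setIT; congr (_ + _ * _); first exact/esym/HE.
  exact: Pmid.
have : (H y <= G y)%R by exact: HG.
(* Without an atom at [y], the bounds [H y <= c <= G y] pin down [c]. *)
rewrite le_eqVlt => /predU1P[e|HGlt].
  rewrite -e subrr mule0 adde0; congr (_%:E); apply/le_anti.
  by rewrite Hc e hge.
have p0 : (0 < G y - H y)%R by rewrite subr_gt0.
(* On an atom of positive mass the condition reads [clamp01 u < (c - H y) / (G y - H y)], a ratio in
   [[0, 1]]. *)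
have -> : k = ((c - H y) / (G y - H y))%:E.
  rewrite -unif01_clamp01_lt.
    congr (unif01 _); apply/seteqP; split => u /=;
    by rewrite ltr_pdivlMr// ltrBrDl.
  rewrite divr_ge0 ?subr_ge0// ?HG//= ler_pdivrMr// mul1r lerD2r.
  exact: hge.
by rewrite -EFinM -EFinD divfK ?gt_eqF// addrC subrK.
Qed.

(** It suffices to compare the rays [[c, +oo[]. For [0 < c < 1] this is [level_lt]; for [c <= 0] the
    mass is full since [level] is nonnegative, and for [c >= 1] it is squeezed to zero. *)
Lemma level_law (A : set R) : measurable A ->
  (P \x unif01) (level @^-1` A) = unif01 A.
Proof.
apply: (@law_unique _ _ _ _ _ (P \x unif01) unif01 level id) => //.
  exact: measurable_level.
have mlev c : measurable [set z | (level z < c)%R].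
  have := measurable_level measurableT (measurable_itv `]-oo, c[).
  by rewrite setTI preimage_itvNyo.
have geE c : [set z | (c <= level z)%R] = ~` [set z | (level z < c)%R].
  by apply/seteqP; split => z /=; rewrite leNgt => /negP.
have lev01 z : (0 <= level z <= 1)%R.
  have /andP[h g] := level_bounds z; apply/andP; split.
    by rewrite (le_trans _ h)// fine_ge0.
  by rewrite (le_trans g)// -lee_fin GE cdf_le1.
have lev c : (0 < c < 1)%R ->
    (P \x unif01) [set z | (c <= level z)%R] = (1 - c)%:E.
  move=> c01; rewrite geE (@probability_setC _ _ _ (P \x unif01))//.
  by rewrite [X in _ - X]level_lt.
move=> c /=.
have -> : [set u : measurableTypeR R | (c <= u)%R] = `[c, +oo[%classic.
  by apply/seteqP; split => u /=; rewrite in_itv/= andbT.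
rewrite unif01E; last exact: measurable_itv.
have [c0|c0] := leP c 0%R.
  rewrite (_ : [set _ | _] = setT); last first.
    apply/seteqP; split => // z _ /=; have /andP[] := lev01 z.
    by move=> + _; exact: le_trans.
  rewrite (@probability_setT _ _ _ (P \x unif01)) setIidl.
    by rewrite lebesgue_measure_itv/= lte_fin ltr01 sube0.
  move=> u /=; rewrite !in_itv/= andbT => /andP[u0 _].
  exact: le_trans u0.
have [c1|c1] := ltP c 1%R.
  rewrite lev ?c0// (_ : _ `&` _ = `[c, 1%R]%classic).
    by rewrite lebesgue_measure_itv/= lte_fin c1.
  apply/seteqP; split => u /=; rewrite !in_itv/= andbT.
    by move=> [/andP[_ ->] ->].
  by move=> /andP[cu ->]; rewrite cu (le_trans _ cu)// ltW.
have -> : lebesgue_measure (`[0%R, 1%R]%classic `&` `[c, +oo[%classic) = 0.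
  have mI : measurable (`[0%R, 1%R]%classic `&` `[c, +oo[%classic : set R).
    exact: measurableI.
  apply/eqP; rewrite -measure_le0 -(lebesgue_measure_set1 (1%R : R)).
  apply: le_measure; rewrite ?inE// => u /=; rewrite !in_itv/= andbT.
  by move=> [/andP[_ u1] cu]; apply/le_anti; rewrite u1 (le_trans c1).
have mge : measurable [set z | (c <= level z)%R].
  by rewrite geE; exact: measurableC.
have mfin : (P \x unif01) [set z | (c <= level z)%R] \is a fin_num.
  rewrite ge0_fin_numE; last exact: (@measure_ge0 _ _ _ (P \x unif01)).
  rewrite (le_lt_trans _ (ltry 1))//.
  exact: (@probability_le1 _ _ _ (P \x unif01)).
rewrite -(fineK mfin); congr (_%:E).
set a := fine _.
have aE : (a%:E = (P \x unif01) [set z | (c <= level z)%R]) by rewrite fineK.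
have a0 : (0 <= a)%R by rewrite fine_ge0// (@measure_ge0 _ _ _ (P \x unif01)).
have a1 : (a <= 1)%R.
  by rewrite -lee_fin aE; exact: (@probability_le1 _ _ _ (P \x unif01)).
(* As [c >= 1], the event is contained in [e <= level], of mass [1 - e], for each such [e]. *)
have ale e : (0 < e < 1)%R -> (a <= 1 - e)%R.
  move=> /[dup] e01 /andP[_ e1]; rewrite -lee_fin aE -(lev e e01).
  apply: (@le_measure _ _ _ (P \x unif01)); rewrite ?inE//.
    by rewrite geE; exact: measurableC.
  by move=> z /=; apply: le_trans; rewrite (le_trans (ltW e1)).
apply/eqP; rewrite eq_le a0 andbT leNgt; apply/negP => apos.
(* This choice gives [a <= a / 2], impossible for a positive [a]. *)
have := ale (1 - a / 2)%R; have -> : (0 < 1 - a / 2 < 1)%R by lra.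
by move=> /(_ isT); lra.
Qed.

End level.

(** * Measurability for the spectral range and the extended space *)

Section spectral_val.
Context {R : realType} (alpha : spectral_function R).

Lemma continuous_spectral_val : continuous (@spectral_val R alpha).
Proof. exact: initial_continuous. Qed.

Lemma open_measurable_borel (Y : ptopologicalType) (A : set (borel Y)) :
  open (A : set Y) -> measurable A.
Proof. exact: sub_sigma_algebra. Qed.

Lemma measurable_borel (Y : ptopologicalType) d (T : measurableType d)
    (f : T -> borel Y) :
  (forall A : set Y, open A -> measurable (f @^-1` A)) -> measurable_fun setT f.
Proof.
move=> mf; refine (@measurability _ _ _ _ _ _ _ _ _) => //.
move=> _ [A oA <-].
by rewrite setTI; exact: mf.
Qed.

Lemma continuous_measurable_borel (Y : ptopologicalType) (f : Y -> R) :
  continuous f -> measurable_fun setT (f : borel Y -> R).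
Proof.
move=> cf; apply: measurable_fun_gtr => s.
apply: open_measurable_borel.
have -> : [set x | s < f x] = f @^-1` `]s, +oo[%classic.
  by apply/seteqP; split => x /=; rewrite in_itv/= andbT.
by apply: open_comp => [x _|]; [exact: cf|exact: interval_open].
Qed.

Definition spectral_pt (m : R) : spectral_range alpha :=
  exist _ (spectral_ext alpha m) (mem_set (spectral_ext_itv alpha m)).

Lemma spectral_ptK m : spectral_val (spectral_pt m) = spectral_ext alpha m.
Proof. by []. Qed.

Lemma spectral_val_inj : injective (@spectral_val R alpha).
Proof. by move=> x y xy; exact: val_inj. Qed.

Lemma spectral_val_ge0 (x : spectral_range alpha) : 0 <= spectral_val x.
Proof.
case: x => x xa; rewrite /spectral_val/=.
move: (set_mem xa); rewrite /= in_itv/= => /andP[ax _].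
by apply: le_trans ax; apply: spectral_ge0; rewrite in_itv/= lexx ler01.
Qed.

End spectral_val.

Section measurable_pair.
Context {R : realType} (alpha : spectral_function R).
Context (n : nat) (X : 'I_n -> ptopologicalType).
Local Notation Y := (product_space X).

(* [spectral_range alpha] is second countable, so every open set of the product
   is a countable union of rectangles. *)
Lemma measurable_extended_pair d (T : measurableType d)
    (h : T -> spectral_range alpha) (k : T -> borel Y) :
  measurable_fun setT (fun z => spectral_val (h z)) -> measurable_fun setT k ->
  measurable_fun setT (fun z => (h z, k z) : borel (extended_space alpha X)).
Proof.
move=> mh mk; apply: measurable_borel => O oO.
(* [V q r] is the largest open set whose product with the strip []q, r[] lies in [O]. The union over
   all such [W] stays open, so countability is asked only of the strips. *)
pose V (q r : rat) : set Y := \bigcup_(W in [set W : set Y | open W /\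
  forall x y, ratr q < spectral_val x < ratr r -> W y -> O (x, y)]) W.
have oV q r : open (V q r) by apply: bigcup_open => W [].
rewrite (_ : _ @^-1` O = \bigcup_(q : rat) \bigcup_(r : rat)
    ([set z | ratr q < spectral_val (h z) < ratr r] `&` k @^-1` V q r)).
  apply: bigcupT_measurable_rat => q; apply: bigcupT_measurable_rat => r.
  apply: measurableI; last first.
    rewrite -[X in measurable X]setTI; apply: mk => //.
    exact: open_measurable_borel.
  rewrite [X in measurable X](_ : _ = setT `&`
      (fun z => spectral_val (h z)) @^-1` `]ratr q, ratr r[%classic).
    exact: mh.
  by rewrite setTI; apply/seteqP; split => z /=; rewrite in_itv.
apply/seteqP; split => [z /= Oz|z [q _ [r _ [/= qr [W [_ WO]]]]]];
  last exact: WO.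
have : nbhs ((h z, k z) : extended_space alpha X) O by exact: open_nbhs_nbhs.
move=> [[A B]] /= [nA nB] ABO.
have [_ /= [[W oW <-] /= Wz WA]] := nA.
have [e /= e0 eW] : nbhs (spectral_val (h z)) W by exact: open_nbhs_nbhs.
have lo : spectral_val (h z) - e < spectral_val (h z) by rewrite ltrBlDr ltrDl.
have hi : spectral_val (h z) < spectral_val (h z) + e by rewrite ltrDl.
have [q] := rat_in_itvoo lo; have [r] := rat_in_itvoo hi.
rewrite !in_itv/= => /andP[hr re] /andP[eq qh].
exists q => //; exists r => //; split; first by rewrite /= qh.
exists (interior B); last exact: nB.
split; first exact: open_interior.
move=> x y /andP[qx xr] /interior_subset By; apply: ABO; split => //=.
apply: WA => /=; apply: eW.
by change (`|spectral_val (h z) - spectral_val x| < e); rewrite ltr_norml; lra.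
Qed.

End measurable_pair.

(** * Marginals of extended couplings and lifts of couplings *)

Section marginals.
Context {R : realType} (alpha : spectral_function R).
Context (n : nat) (X : 'I_n -> ptopologicalType).
Context (mu : forall i, probability (borel (X i)) R).
Local Notation Y := (product_space X).
Local Open Scope ereal_scope.

Lemma measurable_spectral_pt (A : set (spectral_range alpha)) :
  measurable (A : set (borel [the ptopologicalType of spectral_range alpha])) ->
  measurable (@spectral_pt R alpha @^-1` A).
Proof.
move=> mA; have mpt : measurable_fun setT (@spectral_pt R alpha :
    _ -> borel [the ptopologicalType of spectral_range alpha]).
  apply: measurable_borel => O oO.
  have [W oW <-] := oO.
  rewrite -comp_preimage -[X in measurable X]setTI.
  apply: measurable_spectral_ext => //; exact: open_measurable.
by rewrite -[X in measurable X]setTI; exact: mpt.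
Qed.

(** [spectral_pt] agrees with [alpha] on [[0, 1]], and injectivity of [spectral_val] turns the
    direct image in [spectral_law] into a plain preimage. *)
Lemma spectral_lawE (A : set (spectral_range alpha)) :
  measurable (A : set (borel [the ptopologicalType of spectral_range alpha])) ->
  spectral_law A = unif01 (@spectral_pt R alpha @^-1` A).
Proof.
move=> mA; rewrite unif01E.
  rewrite /spectral_law; congr (lebesgue_measure _).
  apply/seteqP; split => m /= [m01].
    move=> [x Ax xm]; split => //; suff -> : spectral_pt alpha m = x by [].
    by apply: spectral_val_inj; rewrite xm spectral_ptK spectral_extE.
  move=> Am; split => //; exists (spectral_pt alpha m) => //.
  by rewrite spectral_ptK spectral_extE.
exact: measurable_spectral_pt.
Qed.

Lemma measurable_spectral_val1 :
  measurable_fun setT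
    (fun z : borel (extended_space alpha X) => spectral_val z.1).
Proof.
apply: continuous_measurable_borel => z.
by apply: continuous_comp; [exact: cvg_fst|exact: continuous_spectral_val].
Qed.

Lemma spectral_tail (q : probability (borel (extended_space alpha X)) R) t :
  extended_coupling mu q ->
  q [set z | (t < spectral_val z.1)%R] =
  unif01 [set m : measurableTypeR R | (t < spectral_ext alpha m)%R].
Proof.
move=> [q1 _].
have mA : measurable ([set x : spectral_range alpha | (t < spectral_val x)%R] :
    set (borel [the ptopologicalType of spectral_range alpha])).
  apply: measurable_gtr; apply: continuous_measurable_borel.
  exact: continuous_spectral_val.
by have := q1 _ mA; rewrite spectral_lawE.
Qed.

Lemma measurable_coord i (A : set (borel (X i))) : measurable A ->
  measurable [set x : borel Y | A (x i)].
Proof.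
move=> mA; have mp : measurable_fun setT (fun x : borel Y => x i : borel (X i)).
  apply: measurable_borel => O oO; apply: open_measurable_borel.
  by apply: open_comp oO => x _; exact: proj_continuous.
by rewrite -[X in measurable X]setTI; exact: mp.
Qed.

(** The lift is the law of [(alpha(L), x)] under [g \x unif01], with [L] the distributional
    transform of [b]: [level_law] gives the zeroth marginal and [level_comonotone] the
    comonotonicity. *)
Lemma lift_exists (b : {mfun borel Y >-> R}) (g : probability (borel Y) R) :
  coupling mu g -> exists q : probability (borel (extended_space alpha X)) R,
  [/\ extended_coupling mu q,
      forall A : set (borel Y), measurable A -> q [set z | A z.2] = g A &
      comonotone q (fun z => spectral_val z.1) (fun z => b z.2)].
Proof.
move=> gmu.
pose phi (z : borel Y * measurableTypeR R) : borel (extended_space alpha X) :=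
  (spectral_pt alpha (level (P := g) b z), z.1).
have mphi : measurable_fun setT phi.
  apply: measurable_extended_pair; last exact: measurable_fst.
  apply: (measurableT_comp (measurable_spectral_ext alpha)).
  exact: measurable_level.
pose q : probability (borel (extended_space alpha X)) R :=
  distribution (g \x unif01) (mfun_Sub (mem_set mphi)).
have q2 (A : set (borel Y)) : measurable A -> q [set z | A z.2] = g A.
  move=> mA; transitivity ((g \x unif01) (A `*` setT)).
    by congr ((g \x unif01) _); apply/seteqP; split => -[x u] //= [].
  transitivity (g A * unif01 (setT : set (measurableTypeR R))).
    by rewrite [LHS]product_measure1E.
  by rewrite [X in _ * X]probability_setT mule1.
exists q; split => //.
- split=> [A mA|i A mA]; last first.
    by rewrite -gmu// -q2//; exact: measurable_coord.
  rewrite spectral_lawE//.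
  have mA' : measurable (@spectral_pt R alpha @^-1` A).
    exact: measurable_spectral_pt.
  by rewrite -(level_law (P := g) b mA').
- move=> t s.
  exact: (@level_comonotone _ _ _ g b _ (@spectral_ext_homo R alpha) t s).
Qed.

End marginals.

(** * Supports of planar laws and comonotonicity *)

Lemma open_rectangle (S T : topologicalType) (A : set S) (B : set T) :
  open A -> open B -> open (A `*` B).
Proof.
move=> oA oB; rewrite openE => -[x y] [/= Ax By].
by exists (A, B) => //; split; exact: open_nbhs_nbhs.
Qed.

Section support.
Context d (T : measurableType d) (R : realType) (P : probability T R).
Context (f g : T -> R).
Hypothesis mf : measurable_fun setT f.
Hypothesis mg : measurable_fun setT g.
Local Open Scope ereal_scope.

Let law (A : set (R * R)) := P [set x | A (f x, g x)].

Let rect (q r s t : rat) := [set x | (ratr q < f x < ratr r)%R /\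
                                     (ratr s < g x < ratr t)%R].

Let mrect q r s t : measurable (rect q r s t).
Proof.
have -> : rect q r s t = f @^-1` `]ratr q, ratr r[%classic `&`
                         g @^-1` `]ratr s, ratr t[%classic.
  by apply/seteqP; split => x /=; rewrite !in_itv.
by apply: measurableI; rewrite -[X in measurable X]setTI; [exact: mf|exact: mg].
Qed.

Let box (q r s t : rat) : set (R * R) :=
  [set z | (ratr q < z.1 < ratr r)%R /\ (ratr s < z.2 < ratr t)%R].

Let open_box (U : set (R * R)) z : open U -> U z ->
  exists q r s t, box q r s t z /\ box q r s t `<=` U.
Proof.
move=> oU Uz; have : nbhs z U by exact: open_nbhs_nbhs.
move=> [[V W]] /= [[e1 /= e10 V1] [e2 /= e20 W2]] VWU.
have lo1 : (z.1 - e1 < z.1)%R by rewrite ltrBlDr ltrDl.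
have hi1 : (z.1 < z.1 + e1)%R by rewrite ltrDl.
have lo2 : (z.2 - e2 < z.2)%R by rewrite ltrBlDr ltrDl.
have hi2 : (z.2 < z.2 + e2)%R by rewrite ltrDl.
have [q] := rat_in_itvoo lo1; have [r] := rat_in_itvoo hi1.
have [s] := rat_in_itvoo lo2; have [t] := rat_in_itvoo hi2.
rewrite !in_itv/= => ht hs hr hq; exists q, r, s, t; split.
  by rewrite /box/=; split; lra.
move=> w [/andP[w1 w1'] /andP[w2 w2']]; apply: VWU; split.
  by apply: V1; rewrite /ball_/= ltr_norml; lra.
by apply: W2; rewrite /ball_/= ltr_norml; lra.
Qed.

(** An open set of the plane is the union of the rational boxes that it contains, which are
    countably many. *)
Let measurable_open (U : set (R * R)) : open U ->
  measurable [set x | U (f x, g x)].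
Proof.
move=> oU.
pose F q r s t := if `[< box q r s t `<=` U >] then rect q r s t else set0.
rewrite (_ : [set _ | _] = \bigcup_q \bigcup_r \bigcup_s \bigcup_t F q r s t).
  do 4 apply: bigcupT_measurable_rat => ?.
  by rewrite /F; case: asboolP => ?; [exact: mrect|exact: measurable0].
apply/seteqP; split => [x Ux|x [q _ [r _ [s _ [t _]]]]].
  have [q [r [s [t [zbox sub]]]]] := open_box oU Ux.
  exists q => //; exists r => //; exists s => //; exists t => //.
  by rewrite /F; case: asboolP.
by rewrite /F; case: asboolP => // sub rx; exact: sub.
Qed.

Lemma negligible_bigcup_rat (F : rat -> set T) :
  (forall q, P.-negligible (F q)) -> P.-negligible (\bigcup_q F q).
Proof.
move=> F0.
apply: (@negligibleS _ _ _ _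
    (\bigcup_n if unpickle n is Some q then F q else set0)).
  by move=> x [q _ Fx]; exists (pickle q); [exact: I|rewrite pickleK].
apply: negligible_bigcup => n; case: unpickle => // .
exact: negligible_set0.
Qed.

(** Otherwise each point of [B] is sent into a rational box of mass zero, and countably many null
    preimages cover [B]. *)
Lemma support_meets (B : set T) : P B != 0 -> measurable B ->
  exists2 x, B x & measure_support law (f x, g x).
Proof.
move=> B0 mB; apply: contrapT => nB; move: B0 => /eqP; apply.
pose F q r s t := if `[< P (rect q r s t) = 0 >] then rect q r s t else set0.
have mF q r s t : measurable (F q r s t).
  by rewrite /F; case: asboolP => ?; [exact: mrect|exact: measurable0].
have F0 q r s t : P.-negligible (F q r s t).
  by apply/negligibleP => //; rewrite /F; case: asboolP => //; rewrite measure0.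
apply/negligibleP => //.
apply: (@negligibleS _ _ _ _
  (\bigcup_q \bigcup_r \bigcup_s \bigcup_t F q r s t));
  last by do 4 apply: negligible_bigcup_rat => ?; exact: F0.
move=> x Bx.
have /existsNP[U /not_implyP[oU /not_implyP[Ux /negP U0]]] :
    ~ measure_support law (f x, g x) by move=> sx; apply: nB; exists x.
have [q [r [s [t [zbox sub]]]]] := open_box oU Ux.
exists q => //; exists r => //; exists s => //; exists t => //.
rewrite /F; case: asboolP => // rect0; exfalso; apply: rect0.
apply/eqP; rewrite -measure_le0; move: U0; rewrite -leNgt; apply: le_trans.
apply: le_measure; rewrite ?inE//; first exact: measurable_open.
by move=> y ?; exact: sub.
Qed.

(** Two charged opposite quadrants would each contain a point of the support, and these points
    violate monotonicity. *)
Lemma comonotone_support : monotone_increasing_support law -> comonotone P f g.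
Proof.
move=> mono t s.
have mB := measurableI _ _ (measurable_gtr t mf) (measurable_ler s mg).
have mC := measurableI _ _ (measurable_ler t mf) (measurable_gtr s mg).
apply: contrapT => /not_orP[/eqP B0 /eqP C0].
have [x [tf gs] sx] := support_meets B0 mB.
have [y [ft sg] sy] := support_meets C0 mC.
by have := mono _ _ sx sy; rewrite /= nmulr_lge0; lra.
Qed.

(** Two crossing points of the support have opposite open quadrants of positive mass around them,
    separated by gaps in both coordinates, which the hypothesis excludes. *)
Lemma support_uncrossed :
  (forall t0 t1 s0 s1 : R, (t0 < t1)%R -> (s0 < s1)%R ->
    P [set x | (t1 < f x)%R /\ (g x <= s0)%R] = 0 \/
    P [set x | (f x <= t0)%R /\ (s1 < g x)%R] = 0) ->
  monotone_increasing_support law.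
Proof.
move=> unc.
have cross p q : measure_support law p -> measure_support law q ->
    (p.1 < q.1)%R -> (q.2 < p.2)%R -> False.
  move=> sp sq pq1 qp2.
  pose a := (q.1 - p.1)%R; pose c := (p.2 - q.2)%R.
  have a0 : (0 < a)%R by rewrite subr_gt0.
  have c0 : (0 < c)%R by rewrite subr_gt0.
  (* Cutting each gap at a third and at half puts [p] left of [t0] and above [s1], and [q] right of
     [t1] and below [s0]. *)
  pose t0 := (p.1 + a / 3)%R; pose t1 := (p.1 + a / 2)%R.
  pose s0 := (q.2 + c / 3)%R; pose s1 := (q.2 + c / 2)%R.
  have t01 : (t0 < t1)%R by rewrite /t0 /t1; lra.
  have s01 : (s0 < s1)%R by rewrite /s0 /s1; lra.
  have pU : 0 < law (`]-oo, t0[%classic `*` `]s1, +oo[%classic).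
    apply: sp; first by apply: open_rectangle; exact: interval_open.
    by split; rewrite /= in_itv/= ?andbT /t0 /s1 /c; lra.
  have qU : 0 < law (`]t1, +oo[%classic `*` `]-oo, s0[%classic).
    apply: sq; first by apply: open_rectangle; exact: interval_open.
    by split; rewrite /= in_itv/= ?andbT /t1 /s0 /a; lra.
  have mP (A B : set T) : measurable A -> measurable B -> A `<=` B ->
      0 < P A -> P B = 0 -> False.
    move=> mA mB AB A0 B0; have : P A <= P B by apply: le_measure; rewrite ?inE.
    by rewrite B0 leNgt A0.
  have [h|h] := unc t0 t1 s0 s1 t01 s01.
    apply: (mP _ _ _ _ _ qU h).
    - by apply: measurable_open; apply: open_rectangle; exact: interval_open.
    - exact: (measurableI _ _ (measurable_gtr t1 mf) (measurable_ler s0 mg)).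
    - by move=> x [] /=; rewrite !in_itv/= andbT => tf /ltW.
  apply: (mP _ _ _ _ _ pU h).
  - by apply: measurable_open; apply: open_rectangle; exact: interval_open.
  - exact: (measurableI _ _ (measurable_ler t0 mf) (measurable_gtr s1 mg)).
  - by move=> x [] /=; rewrite !in_itv/= andbT => /ltW.
move=> p q sp sq; rewrite leNgt; apply/negP => pq0.
have [pq|qp|pq] := ltgtP p.1 q.1.
- apply: (cross p q) => //.
  by move: pq0; rewrite nmulr_rlt0 ?subr_lt0// subr_gt0.
- apply: (cross q p) => //.
  by move: pq0; rewrite pmulr_rlt0 ?subr_gt0// subr_lt0.
- by move: pq0; rewrite pq subrr mul0r ltxx.
Qed.

End support.

(** A difference that attains its bound attains it in each term; finiteness prevents infinite values
    from hiding a loss. *)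
Lemma suber_eq_extremal (R : realType) (a b a' b' : \bar R) :
  (a <= a' -> b' <= b -> a' - b' \is a fin_num -> a - b = a' - b' ->
   a = a' /\ b = b')%E.
Proof.
move=> aa' bb' fin e; have := fin; have := fin; rewrite -{1}e !fin_numB.
case: a aa' e => [a| |] //; case: b bb' => [b| |] //.
case: a' fin => [a'| |] //; case: b' => [b'| |] // _.
rewrite !lee_fin => bb' aa' []; move=> e _ _.
by split; congr (_%:E); lra.
Qed.

(** * Comparison of the objective with the risk of the marginal *)

Section objective.
Context {R : realType} (alpha : spectral_function R).
Context (n : nat) (X : 'I_n -> ptopologicalType).
Context (mu : forall i, probability (borel (X i)) R).
Variable b : {mfun borel (product_space X) >-> R}.
Variable q : probability (borel (extended_space alpha X)) R.
Hypothesis qmu : extended_coupling mu q.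
Local Open Scope ereal_scope.

Local Notation risk :=
  (spectral_risk alpha (distribution (output_marginal q) b)).
Local Notation f :=
  (fun z : borel (extended_space alpha X) => spectral_val z.1).
Local Notation g := (fun z : borel (extended_space alpha X) => b z.2).
Local Notation J := (\int[q]_z (spectral_val z.1 * b z.2)%:E).

Lemma output_marginal_coupling : coupling mu (output_marginal q).
Proof. by move=> i A mA; exact: (qmu.2 i A mA). Qed.

Let mf : measurable_fun setT f.
Proof. exact: measurable_spectral_val1. Qed.

Let mg : measurable_fun setT g.
Proof.
exact: (measurable_funPT (b \o @drop_spectral R n X alpha)).
Qed.

Let f0 z : (0 <= f z)%R. Proof. exact: spectral_val_ge0. Qed.

(** [u] and [v] form the reference pair on the uniform space: comonotone, with the marginal laws of
    [f] and [g] under [q]. *)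
Let u := spectral_ext alpha : measurableTypeR R -> R.
Let v := @quantile_fun _ _ _ (output_marginal q) b : measurableTypeR R -> R.

Let meas_u : measurable_fun setT u.
Proof. exact: measurable_spectral_ext. Qed.

Let meas_v : measurable_fun setT v.
Proof. exact: measurable_quantile_fun. Qed.

Let u0 m : (0 <= u m)%R. Proof. exact: spectral_ext_ge0. Qed.

Let tail_u t : q [set z | (t < f z)%R] = unif01 [set m | (t < u m)%R].
Proof. exact: spectral_tail qmu. Qed.

Let tail_v s : q [set z | (s < g z)%R] = unif01 [set m | (s < v m)%R].
Proof. by rewrite quantile_fun_tail. Qed.

Let comon_uv : comonotone unif01 u v.
Proof.
apply: quantile_fun_comonotone; first exact: measurable_spectral_ext.
exact: spectral_ext_homo.
Qed.

Let JE : J = posint q f g - negint q f g.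
Proof. exact: integral_posint_negint. Qed.

Let riskE : risk = posint unif01 u v - negint unif01 u v.
Proof. exact: spectral_riskE. Qed.

Let pos_le : posint q f g <= posint unif01 u v.
Proof. exact: posint_le. Qed.

Let neg_le : negint unif01 u v <= negint q f g.
Proof. exact: negint_le. Qed.

Lemma objective_le_risk : J <= risk.
Proof. by rewrite JE riskE leeB. Qed.

(** Both pairs are then comonotone with the same marginals, so the rearrangement inequality holds in
    both directions. *)
Lemma comonotone_objective : comonotone q f g -> J = risk.
Proof.
move=> cq; rewrite JE riskE; congr (_ - _); apply/le_anti/andP; split => //.
  by apply: posint_le => //.
by apply: negint_le => //.
Qed.

(** Equality of finite differences splits into equality of the positive and of the negative parts,
    to which [uncrossed] applies. *)
Lemma objective_comonotone : risk \is a fin_num -> J = risk ->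
  monotone_increasing_support (output_law b q).
Proof.
rewrite JE riskE => fin Jrisk.
have [posE negE] := suber_eq_extremal pos_le neg_le fin Jrisk.
move: fin; rewrite fin_numB => /andP[posfin negfin].
apply: (support_uncrossed mf mg) => t0 t1 s0 s1 t01 s01.
apply: (uncrossed mf mg meas_u meas_v f0 u0 tail_u tail_v comon_uv) => //.
  by rewrite ltey_eq posfin.
by rewrite ltey_eq negfin.
Qed.

Lemma support_objective :
  monotone_increasing_support (output_law b q) -> J = risk.
Proof. by move=> mono; apply/comonotone_objective/comonotone_support. Qed.

End objective.

(** The marginal of a lift of [g] is known to agree with [g] only on measurable sets; since
    quantiles see just the distribution function, this suffices for equal risks. *)
Lemma eq_spectral_risk (R : realType) (alpha : spectral_function R)
    (nu nu' : probability R R) :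
  (forall x, nu `]-oo, x]%classic = nu' `]-oo, x]%classic) ->
  spectral_risk alpha nu = spectral_risk alpha nu'.
Proof.
move=> nuE; apply: eq_integral => m _; congr (ereal_inf (image _ _) * _)%E.
by apply/seteqP; split => x /=; rewrite nuE.
Qed.

(** * Characterization of the maximizers *)

Theorem theorem18 (R : realType) (d : nat) (X : 'I_d -> ptopologicalType)
  (hX : forall i, polish R (X i))
  (mu : forall i, probability (borel (X i)) R)
  (b : {mfun borel (product_space X) >-> R})
  (alpha : spectral_function R)
  (hR : forall g, coupling mu g ->
     spectral_risk alpha (distribution g b) \is a fin_num)
  (p : probability (borel (extended_space alpha X)) R)
  (hp : extended_coupling mu p) :
  maximizes
    (fun q : probability (borel (extended_space alpha X)) R =>
       (\int[q]_z (spectral_val z.1 * b z.2)%:E)%E)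
    (extended_coupling mu) p
  <->
  maximizes (fun g => spectral_risk alpha (distribution g b))
    (coupling mu) (output_marginal p)
  /\ monotone_increasing_support (output_law b p).
Proof.
have cp := output_marginal_coupling hp.
split=> [[_ maxp]|[[_ maxg] mono]]; last first.
  (* The objective at [p] is the risk of its marginal, which dominates the risk of the marginal of
     [q], hence the objective at [q]. *)
  split=> // q hq; rewrite (support_objective hp mono).
  apply: le_trans (objective_le_risk b hq) _.
  exact/maxg/output_marginal_coupling.
(* A comonotone lift realizes the risk of [g] as an objective value, which [p] dominates. *)
have risk_le g : coupling mu g -> (spectral_risk alpha (distribution g b) <=
    \int[p]_z (spectral_val z.1 * b z.2)%:E)%E.
  move=> hg; have [q [hq qg cq]] := lift_exists alpha b hg.
  rewrite (le_trans _ (maxp q hq))// (comonotone_objective hq cq).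
  rewrite (eq_spectral_risk alpha
    (nu' := distribution (output_marginal q) b))// => x.
  by rewrite -[LHS]qg//; exact: measurable_funPTI.
split.
  split=> // g hg; apply: le_trans (risk_le g hg) _.
  exact: objective_le_risk hp.
(* The objective at [p] is squeezed to the risk of its own marginal, finite by [hR]. *)
apply: (objective_comonotone hp (hR _ cp)).
by apply/le_anti; rewrite risk_le// (objective_le_risk b hp).
Qed.
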